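(* Let $m \ge 2$ and $n \ge 1$ be integers. Let $G$ be a graph with maximum degree $\Delta \ge 1$ whose vertex set admits a partition $V(G) = U_1 \cup U_2 \cup \dots \cup U_m$ into independent sets with $|U_i| \le n$ for all $i \in [m]$. Let $c$ be a globally $\left(\frac{n}{110\Delta^2}\right)$-bounded coloring of the complete balanced $m$-partite graph $K_{m\otimes n}$. Then $c$ is $G$-rainbow, i.e. the colored graph $K_{m\otimes n}$ contains a rainbow copy of $G$.
   Context: $K_{m\otimes n}$ denotes the complete $m$-partite graph with exactly $n$ vertices in each of its $m$ classes. A coloring of a graph $H$ is an arbitrary edge-coloring $c: E(H)\to\mathbb{N}$ (not necessarily proper). For a real number $k$, a coloring $c$ is globally $k$-bounded if every color is used on at most $k$ edges of $H$. A copy of $G$ in $H$ is a subgraph of $H$ isomorphic to $G$; it is rainbow if all its edges receive pairwise distinct colors. A coloring $c$ of $H$ is $G$-rainbow if $H$ contains a rainbow copy of $G$. *)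

(* Defs.v *)
From HB Require Import structures.
From mathcomp Require Import all_boot all_order all_algebra.
From mathcomp Require Import reals.
Set Implicit Arguments.
Unset Strict Implicit.
Unset Printing Implicit Defensive.
Import Order.TTheory GRing.Theory Num.Theory.
Local Open Scope ring_scope.

Record sgraph := SGraph {
  vertex :> finType;
  adj : rel vertex;
  adj_sym : symmetric adj;
  adj_irrefl : irreflexive adj }.

Definition edges (G : sgraph) : {set {set G}} :=
  [set [set p.1; p.2] | p : G * G & adj p.1 p.2].

Definition max_degree (G : sgraph) : nat :=
  (\max_(x : G) #|[set y : G | adj x y]|)%N.

Definition independent (G : sgraph) (A : {set G}) : Prop :=
  {in A &, forall x y, ~~ adj x y}.

(* Classes may be empty: only disjointness and covering are required. *)
Definition vertex_partition (G : sgraph) (m : nat) (U : 'I_m -> {set G}) : Prop :=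
  \bigcup_(i < m) U i = [set: G] /\
  (forall i j : 'I_m, i != j -> [disjoint U i & U j]).

Section CompleteMultipartite.
Variables m n : nat.

Definition multipartite_adj : rel ('I_m * 'I_n)%type :=
  fun x y => x.1 != y.1.

Lemma multipartite_adj_sym : symmetric multipartite_adj.
Proof. by move=> x y; rewrite /multipartite_adj eq_sym. Qed.

Lemma multipartite_adj_irrefl : irreflexive multipartite_adj.
Proof. by move=> x; rewrite /multipartite_adj eqxx. Qed.

(* The vertex (i, a) is the a-th vertex of the i-th class. *)
Definition complete_multipartite : sgraph :=
  SGraph multipartite_adj_sym multipartite_adj_irrefl.

End CompleteMultipartite.

(* Values outside [edges H] are irrelevant: no definition below uses them. *)
Definition coloring (H : sgraph) : Type := {set H} -> nat.

Definition globally_bounded (R : realType) (H : sgraph) (k : R)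
    (c : coloring H) : Prop :=
  forall j : nat, #|[set E in edges H | c E == j]|%:R <= k.

Definition is_subgraph (H : sgraph) (W : {set H}) (F : {set {set H}}) : Prop :=
  F \subset edges H /\ (forall E, E \in F -> E \subset W).

(* The subgraph (W, F) of H is isomorphic to G; f is the isomorphism, seen as
   a map into H with image W. *)
Definition is_copy (G H : sgraph) (W : {set H}) (F : {set {set H}}) : Prop :=
  is_subgraph W F /\
  (exists f : G -> H,
     [/\ injective f, f @: [set: G] = W
       & forall x y : G, adj x y = ([set f x; f y] \in F)]).

Definition rainbow (H : sgraph) (c : coloring H) (F : {set {set H}}) : Prop :=
  {in F &, injective c}.

Definition has_rainbow_copy (G H : sgraph) (c : coloring H) : Prop :=
  exists (W : {set H}) (F : {set {set H}}), is_copy G W F /\ rainbow c F.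

(* Main.v *)
Require Import Defs.
From mathcomp Require Import all_boot all_order all_algebra all_fingroup.
From mathcomp Require Import reals zify ring lra.
Import Order.TTheory GRing.Theory Num.Theory.
Local Open Scope ring_scope.
Set Implicit Arguments.
Unset Strict Implicit.
Unset Printing Implicit Defensive.

(* Choose, among the injections of V(G) into K_{m (x) n} that respect the classes,
   one avoiding all collisions, i.e. pairs of distinct edges of G sent to two given
   edges of the same color.  Switching images by a permutation of the target shows
   that prescribing l values has conditional probability at most 1 / n^_l given
   that any family of collisions disjoint from the prescription, in domain and in
   image, is avoided.  The lopsided local lemma then applies: if each color is
   used at most k times, the collisions meeting a given one have total probability
   at most 16 Delta^2 k n^3 / n^_4, which is at most 1/4 for 110 Delta^2 k <= n.
   Collisions of adjacent edges weigh n times more (n^_3 instead of n^_4), but there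
   are n times fewer of them, so both kinds are estimated at once. *)

(** * The lopsided local lemma in counting form *)

Definition avoiding (T I : finType) (Om : {set T}) (A : I -> {set T})
    (S : {set I}) : {set T} :=
  [set w in Om | [forall i in S, w \notin A i]].

Section LocalLemma.
Variables (R : realFieldType) (T I : finType) (Om : {set T}) (A : I -> {set T}).
Local Notation avoid := (avoiding Om A).

Lemma avoidingS (S1 S2 : {set I}) : S1 \subset S2 -> avoid S2 \subset avoid S1.
Proof.
move=> sS; apply/subsetP=> w; rewrite !inE => /andP[-> /forall_inP wS] /=.
by apply/forall_inP=> i /(subsetP sS); exact: wS.
Qed.

(** A union bound: a point that avoids [S :\: S1] but not [S] lies in some [A j] with [j] in
    [S :&: S1]. *)
Lemma card_avoidingD (S S1 : {set I}) :
  (#|avoid (S :\: S1)| <=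
    #|avoid S| + \sum_(j in S :&: S1) #|A j :&: avoid (S :\: S1)|)%N.
Proof.
have sub : avoid (S :\: S1) \subset
    avoid S :|: \bigcup_(j in S :&: S1) (A j :&: avoid (S :\: S1)).
  apply/subsetP=> w wD; rewrite inE.
  case: (boolP (w \in avoid S)) => //= wS; apply/bigcupP.
  have /andP[wOm /forall_inP wA] : (w \in Om) && [forall i in S :\: S1, w \notin A i].
    by move: wD; rewrite inE.
  move: wS; rewrite inE wOm /= negb_forall => /existsP[j].
  rewrite negb_imply negbK => /andP[jS wj].
  exists j; last by rewrite inE wj wD.
  rewrite inE jS /=; apply: contraLR wj => jS1; apply: wA.
  by rewrite inE jS jS1.
apply: leq_trans (subset_leq_card sub) _.
apply: leq_trans (leq_card_setU _ _) _; rewrite leq_add2l.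
elim/big_rec2: _ => [|j m U _ le_Um]; first by rewrite cards0.
by apply: leq_trans (leq_card_setU _ _) _; rewrite leq_add2l.
Qed.

(** The weights [p] bound probabilities under the uniform measure on [Om]. By induction on the size
    of [S], each bad event has conditional probability at most [2 * p i] given that [S] is avoided;
    the product form avoids dividing by a count not yet known to be positive. *)
Lemma lopsided_local_lemma (bad : {set I}) (N : rel I) (p : I -> R) :
  (forall i, 0 <= p i) -> reflexive N ->
  (forall i, i \in bad -> \sum_(j in bad | N i j) p j <= 4%:R^-1) ->
  (forall i (S : {set I}), i \in bad -> S \subset bad ->
     {in S, forall j, ~~ N i j} ->
     #|A i :&: avoid S|%:R <= p i * #|avoid S|%:R) ->
  Om != set0 ->
  exists2 w, w \in Om & forall i, i \in bad -> w \notin A i.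
Proof.
move=> p0 Nrefl sum_p lopsided Om0.
have key k : forall S : {set I}, (#|S| <= k)%N -> S \subset bad ->
    forall i, i \in bad -> #|A i :&: avoid S|%:R <= 2%:R * p i * #|avoid S|%:R.
  elim: k => [|k IHk] S Sk Sbad i ibad.
    have -> : S = set0 by apply/eqP; rewrite -cards_eq0 -leqn0.
    apply: le_trans (lopsided _ _ _ _ _) _ => //; first exact: sub0set.
      by move=> j; rewrite inE.
    by rewrite -mulrA ler_peMl ?ler1n // mulr_ge0.
  pose S1 := [set j | N i j]; pose S2 := S :\: S1.
  have S2bad : S2 \subset bad by apply: subset_trans Sbad; apply: subsetDl.
  have le1 : #|A i :&: avoid S|%:R <= p i * #|avoid S2|%:R.
    apply: le_trans (lopsided _ S2 _ _ _) => //.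
      by rewrite ler_nat subset_leq_card // setIS // avoidingS // subsetDl.
    by move=> j; rewrite !inE => /andP[].
  (* By the union bound and induction, restoring the neighbours of [i] costs at most the fraction 2
     * 1/4 = 1/2 of [avoid S2]. *)
  suff le2 : #|avoid S2|%:R <= 2%:R * #|avoid S|%:R :> R.
    apply: le_trans le1 _; rewrite [2%:R * _]mulrC -mulrA.
    by apply: ler_wpM2l.
  have := card_avoidingD S S1; rewrite -/S2 -(ler_nat R) natrD natr_sum.
  have : \sum_(j in S :&: S1) #|A j :&: avoid S2|%:R
      <= \sum_(j in S :&: S1) 2%:R * p j * #|avoid S2|%:R :> R.
    apply: ler_sum => j; rewrite inE => /andP[jS jS1]; apply: IHk => //.
      rewrite -ltnS; apply: leq_trans Sk; apply: proper_card.
      rewrite properEneq subsetDl andbT; apply: contraTneq jS1 => eqS.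
      by move: jS; rewrite -eqS inE => /andP[].
    exact: (subsetP Sbad).
  rewrite -mulr_suml -mulr_sumr.
  have : \sum_(j in S :&: S1) p j <= 4%:R^-1.
    apply: le_trans (sum_p i ibad).
    rewrite [leRHS](bigID (fun j => j \in S :&: S1)) /=.
    rewrite (eq_bigl (fun j => (j \in bad) && N i j && (j \in S :&: S1))).
      by rewrite lerDl sumr_ge0.
    move=> j; rewrite !inE; case: (boolP (j \in S)) => jS /=; last by rewrite andbF.
    by rewrite (subsetP Sbad) //= andbb.
  set s := \sum_(j in _) p j; set x := #|avoid S2|%:R; set y := #|avoid S|%:R.
  have x0 : 0 <= x by rewrite ler0n.
  move=> s4 le_sum le_xy.
  have : s * x <= 4%:R^-1 * x by apply: ler_wpM2r.
  lra.
(* Adding events one at a time keeps the avoiding set nonempty: reflexivity of [N] puts [p i] in its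
   own sum, so [p i] is at most 1/4 and each event removes at most half of what is left. *)
have pos k : forall S : {set I}, #|S| = k -> S \subset bad -> (0 < #|avoid S|)%N.
  elim: k => [|k IHk] S Sk Sbad.
    move/eqP: Sk; rewrite cards_eq0 => /eqP->.
    rewrite card_gt0; case/set0Pn: Om0 => w wOm; apply/set0Pn; exists w.
    by rewrite inE wOm; apply/forall_inP=> i; rewrite inE.
  have /card_gt0P[i iS] : (0 < #|S|)%N by rewrite Sk.
  have ibad := subsetP Sbad _ iS.
  have Sibad : S :\ i \subset bad by apply: subset_trans Sbad; apply: subsetDl.
  have Si0 : (0 < #|avoid (S :\ i)|)%N.
    by apply: IHk Sibad; apply/eqP; rewrite -eqSS -Sk (cardsD1 i S) iS.
  have := card_avoidingD S [set i].
  have -> : S :&: [set i] = [set i] by apply/setIidPr; rewrite sub1set.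
  rewrite big_set1 -(ler_nat R) natrD.
  have := key _ (S :\ i) (leqnn _) Sibad i ibad.
  have pi : p i <= 4%:R^-1.
    apply: le_trans (sum_p i ibad); rewrite (bigD1 i) /=; last by rewrite ibad Nrefl.
    by rewrite lerDl sumr_ge0.
  rewrite -(ltr0n R) in Si0; move: Si0.
  rewrite -(ltr0n R); set x := #|avoid (_ :\ _)|%:R; set y := #|avoid S|%:R.
  move=> x0 le1 le2.
  have : p i * x <= 4%:R^-1 * x by apply: ler_wpM2r => //; apply: ltW.
  lra.
have /card_gt0P[w] := pos _ bad erefl (subxx _).
rewrite inE => /andP[wOm /forall_inP wA]; by exists w.
Qed.
End LocalLemma.

(** * Class-preserving embeddings and switching *)

Lemma perm_extend (V : finType) (K D : eqType) (cl : V -> K) (s : seq D)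
    (g h : D -> V) :
  {in s &, injective g} -> {in s &, injective h} ->
  {in s, forall u, cl (h u) = cl (g u)} ->
  exists sg : {perm V}, [/\ {in s, forall u, sg (g u) = h u},
    forall z, z \notin map g s -> z \notin map h s -> sg z = z
    & forall z, cl (sg z) = cl z].
Proof.
elim: s => [|u s IHs] gi hi hc.
  by exists 1%g; split=> // z; rewrite perm1.
have sub x : x \in s -> x \in u :: s by rewrite inE orbC => ->.
have [us|us] := boolP (u \in s).
  have [||| sg [sg1 sg2 sg3]] := IHs.
  - by move=> x y xs ys; apply: gi; exact: sub.
  - by move=> x y xs ys; apply: hi; exact: sub.
  - by move=> x xs; apply: hc; exact: sub.
  exists sg; split=> //.
  - by move=> x; rewrite inE => /orP[/eqP->|]; exact: sg1.
  - by move=> z /=; rewrite !inE !negb_or => /andP[_ z1] /andP[_]; exact: sg2.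
have [||| sg [sg1 sg2 sg3]] := IHs.
- by move=> x y xs ys; apply: gi; exact: sub.
- by move=> x y xs ys; apply: hi; exact: sub.
- by move=> x xs; apply: hc; exact: sub.
have uu : u \in u :: s by rewrite inE eqxx.
(* The transposition corrects the image of [g u] without disturbing earlier values, as [g] and [h]
   are injective; it exchanges two points of the same class, so classes are preserved. *)
exists (sg * tperm (sg (g u)) (h u))%g; split.
- move=> x; rewrite permM inE => /orP[/eqP->|xs]; first by rewrite tpermL.
  have xu : x != u by apply: contraNneq us => <-.
  rewrite (sg1 x xs) tpermD //.
    rewrite -(sg1 x xs) (inj_eq perm_inj); apply: contraNneq xu => e.
    by rewrite -(gi _ _ uu (sub _ xs) e).
  by apply: contraNneq xu => e; rewrite -(hi _ _ uu (sub _ xs) e).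
- move=> z /=; rewrite !inE !negb_or => /andP[zg zgs] /andP[zh zhs].
  have sgz := sg2 z zgs zhs.
  rewrite permM sgz tpermD //; last by rewrite eq_sym.
  by rewrite -sgz (inj_eq perm_inj) eq_sym.
- move=> z; rewrite permM; case: tpermP => [e|e|_ _]; last exact: sg3.
    by rewrite hc // -(sg3 z) e sg3.
  by rewrite sg3 -hc // -e sg3.
Qed.

Section Embeddings.
Variables (G : finType) (m n : nat) (cl : G -> 'I_m).
Local Notation V := ('I_m * 'I_n)%type.

Definition embeddings : {set {ffun G -> V}} :=
  [set f : {ffun G -> V} | injectiveb f && [forall u, (f u).1 == cl u]].

Lemma embeddingsP (f : {ffun G -> V}) :
  reflect (injective f /\ forall u, (f u).1 = cl u) (f \in embeddings).
Proof.
rewrite inE; apply: (iffP andP) => -[fi fc]; split.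
- exact/injectiveP.
- by move=> u; apply/eqP; move/forallP: fc.
- exact/injectiveP.
- by apply/forallP=> u; apply/eqP.
Qed.

(** Each vertex is placed at its rank within its own class, which is below [n] by the size bound. *)
Lemma embeddings_neq0 :
  (forall i, (#|[set u | cl u == i]| <= n)%N) -> embeddings != set0.
Proof.
move=> fib; pose fb u := enum [set v | cl v == cl u].
have lt u : (index u (fb u) < n)%N.
  apply: leq_trans (fib (cl u)); rewrite cardE index_mem mem_enum inE //.
apply/set0Pn; exists [ffun u => (cl u, Ordinal (lt u))].
apply/embeddingsP; split=> [u v|u]; last by rewrite ffunE.
rewrite !ffunE => -[ec]; rewrite /fb ec => ei.
have uin : u \in fb v by rewrite mem_enum inE ec.
have vin : v \in fb v by rewrite mem_enum inE.
by have := nth_index u uin; rewrite /fb ei nth_index.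
Qed.

Definition extending (L : {set G * V}) : {set {ffun G -> V}} :=
  [set f in embeddings | [forall y in L, f y.1 == y.2]].

Lemma extendingP (L : {set G * V}) (f : {ffun G -> V}) :
  reflect (f \in embeddings /\ {in L, forall y, f y.1 = y.2}) (f \in extending L).
Proof.
rewrite [f \in extending L]inE; apply: (iffP andP) => -[fe fL]; split=> //.
  by move=> y yL; apply/eqP; move/forall_inP: fL; apply.
by apply/forall_inP=> y yL; rewrite fL.
Qed.

Definition clash (y y' : G * V) := (y.1 == y'.1) || (y.2 == y'.2).

(* Switching: composing with a permutation of the target supported on the
   images of [L] under the old and the new assignment creates no event of [S],
   so every prescription of values on the domain of [L] is, inside the avoiding
   set, at least as likely as [L]. *)
Lemma extending_negative_correlation (I : finType) (Ls : I -> {set G * V})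
    (S : {set I}) (L : {set G * V}) :
  {in S, forall j, {in L & Ls j, forall y y', ~~ clash y y'}} ->
  (#|extending L :&: avoiding embeddings (extending \o Ls) S| * n ^_ #|L| <=
     #|avoiding embeddings (extending \o Ls) S|)%N.
Proof.
move=> LS; set B := avoiding _ _ S.
(* In the nonempty case, the witness [f0] shows that [L] is the graph of a class-respecting
   injection on its domain [D]. *)
have [->|/set0Pn[f0]] := eqVneq (extending L :&: B) set0; first by rewrite cards0.
rewrite inE => /andP[/extendingP[/embeddingsP[f0i f0c] f0L] _].
pose D := [set y.1 | y in L].
have cD : #|D| = #|L|.
  apply: card_in_imset => y y' yL y'L e.
  by rewrite (surjective_pairing y) (surjective_pairing y') -!f0L // e.
pose TD := {u : G | u \in D}.
pose tr (f : {ffun G -> V}) : {ffun TD -> 'I_n} := [ffun u => (f (val u)).2].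
have -> : n ^_ #|L| = #|[set t : {ffun TD -> 'I_n} | injectiveb t]|.
  have := card_inj_ffuns TD 'I_n; rewrite card_ord card_sig -cD => <-.
  by apply: eq_card => t; rewrite !inE.
(* The avoiding set is split by the second coordinates taken on [D]. The injective patterns number
   [n ^_ #|L|], and the fibre over each of them receives an injective copy of the left-hand set. *)
rewrite mulnC -sum_nat_const -[leqRHS]sum1_card (partition_big tr predT) //=.
rewrite [leqRHS](bigID (fun t : {ffun TD -> 'I_n} => injectiveb t)) /=.
apply: leq_trans (leq_addr _ _).
rewrite [leqLHS](eq_bigl (fun t : {ffun TD -> 'I_n} => injectiveb t)); last by move=> t; rewrite inE.
apply: leq_sum => t /injectiveP ti; rewrite sum1dep_card.
pose h (u : TD) : V := (cl (val u), t u).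
have [||| sg [sg1 sg2 sg3]] :=
  @perm_extend V 'I_m TD fst (enum {: TD}) (f0 \o val) h.
- by move=> u v _ _ /f0i /val_inj.
- by move=> u v _ _ [_ /ti].
- by move=> u _ /=; rewrite f0c.
have f0h u : sg (f0 (val u)) = h u by apply: (sg1 u); rewrite mem_enum.
pose act (f : {ffun G -> V}) : {ffun G -> V} := [ffun u => sg (f u)].
have act_inj : injective act.
  move=> f g /ffunP e; apply/ffunP=> u.
  by have := e u; rewrite !ffunE; exact: perm_inj.
rewrite -(card_imset (mem (extending L :&: B)) act_inj); apply: subset_leq_card.
apply/subsetP=> _ /imsetP[f /setIP[/extendingP[fO fL] fB] ->].
have /embeddingsP[fi fc] := fO.
have aO : act f \in embeddings.
  apply/embeddingsP; split=> [u v|u]; rewrite !ffunE; last by rewrite sg3.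
  by move/perm_inj/fi.
have ah u : act f (val u) = h u.
  rewrite ffunE -f0h; congr (sg _).
  by have /imsetP[y yL ->] : val u \in D := valP u; rewrite fL // f0L.
rewrite inE; apply/andP; split; last first.
  by apply/eqP/ffunP=> u; rewrite [tr _ _]ffunE ah.
rewrite inE aO /=; apply/forall_inP=> j jS.
(* Were [act f] to extend [Ls j], so would [f], because [sg] then fixes every value prescribed by
   [Ls j]. *)
apply: contraL fB => /extendingP[_ aL].
rewrite inE fO /= negb_forall; apply/existsP; exists j.
rewrite jS /= negbK; apply/extendingP; split=> // y' y'L.
have ay' : sg (f y'.1) = y'.2 by have := aL _ y'L; rewrite ffunE.
suff fix_y' : sg y'.2 = y'.2 by apply: (@perm_inj _ sg); rewrite fix_y'.
apply: sg2; apply/negP=> /mapP[u _ e].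
  have /imsetP[y yL yu] : val u \in D := valP u.
  have := LS j jS y y' yL y'L; rewrite /clash negb_or => /andP[_ /eqP]; apply.
  by rewrite e /= yu f0L.
(* The new image [h u] is taken by [act f] at [u] alone, so [y'.1] would lie in the domain of
   [L]. *)
have /imsetP[y yL yu] : val u \in D := valP u.
have := LS j jS y y' yL y'L; rewrite /clash negb_or => /andP[/eqP ne _]; apply: ne.
have /embeddingsP[ai _] := aO.
by apply: ai; rewrite -yu ah -e aL.
Qed.

End Embeddings.

(** * Counting tools and a falling factorial bound *)

Lemma ler_sum_cover (R : numDomainType) (I J : finType) (P : pred I)
    (Q : pred J) (E : J -> pred I) (F : I -> R) :
  (forall i, 0 <= F i) -> (forall i, P i -> exists2 j, Q j & E j i) ->
  \sum_(i | P i) F i <= \sum_(j | Q j) \sum_(i | E j i) F i.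
Proof.
move=> F0 cover; rewrite (exchange_big_dep predT) //= [leLHS]big_mkcond /=.
apply: ler_sum => i _; case: ifPn => [/cover[j Qj Eji]|_]; last exact: sumr_ge0.
by rewrite (bigD1 j) /= ?Qj // lerDl sumr_ge0.
Qed.

Lemma card_dep_pairs (S T : finType) (Z : {set S}) (r : S -> T -> bool) d :
  {in Z, forall x, (#|[set y | r x y]| <= d)%N} ->
  (#|[set e | (e.1 \in Z) && r e.1 e.2]| <= #|Z| * d)%N.
Proof.
move=> rd; rewrite -sum_nat_const -sum1dep_card.
rewrite -(pair_big_dep (mem Z) r (fun _ _ => 1%N)) /=.
by apply: leq_sum => x xZ; rewrite sum1dep_card rd.
Qed.

Lemma card_set_uniq (T : finType) (A : {set T}) (s : seq T) :
  uniq s -> A =i s -> #|A| = size s.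
Proof. by move=> us /eq_card ->; apply/card_uniqP. Qed.

(** The 64 is 4 times the constant 16 of the collision estimate. The ratio of [n ^_ 4] to [n ^ 4]
    increases to 1, and at 110 it is already above 64/110. *)
Lemma ffact4_bound (n : nat) : (110 <= n)%N -> (64 * n ^ 4 <= 110 * n ^_ 4)%N.
Proof.
move=> n110; have -> : n = (n - 110 + 110)%N by lia.
move: (n - 110)%N => d; rewrite !ffactnSr ffactn0 !expnS expn0.
by rewrite !subn0 -!addnBA //; nia.
Qed.

(** * Collisions and their total weight *)

Section CollisionCount.
Variables (R : realFieldType) (G : sgraph) (m n Delta K : nat) (cl : G -> 'I_m).
Local Notation V := ('I_m * 'I_n)%type.
Local Notation placement := ((G * V) * (G * V))%type.
Variable col : V * V -> nat.
Hypothesis degG : forall x : G, (#|[set y | adj x y]| <= Delta)%N.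
Hypothesis cl_fiber : forall i, (#|[set u | cl u == i]| <= n)%N.
Hypothesis col_bound :
  forall j, (#|[set F : V * V | (F.1.1 < F.2.1)%N && (col F == j)]| <= K)%N.
Hypothesis n_large : (110 * Delta ^ 2 * K <= n)%N.
Hypothesis n110 : (110 <= n)%N.

(* Orienting every edge towards the class of larger index makes an ordered pair
   of assignments represent the placement of an edge without repetition. *)
Definition edge_placement (h : placement) : bool :=
  [&& adj h.1.1 h.2.1, (cl h.1.1 < cl h.2.1)%N,
      h.1.2.1 == cl h.1.1 & h.2.2.1 == cl h.2.1].

Definition placed_edge (h : placement) : V * V := (h.1.2, h.2.2).

(** A set merges coinciding assignments, so its cardinality is the number of values really
    prescribed. *)
Definition assignments (j : placement * placement) :
    {set G * V} :=
  [set j.1.1; j.1.2; j.2.1; j.2.2].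

(** The last condition keeps only realizable pairs, whose assignments are part of an injection. Both
    orders of a pair are included. *)
Definition collisions : {set placement * placement} :=
  [set j | [&& edge_placement j.1, edge_placement j.2,
    placed_edge j.1 != placed_edge j.2,
    col (placed_edge j.1) == col (placed_edge j.2)
    & extending cl (assignments j) != set0]].

(** The bound that switching gives for the conditional probability of the event. *)
Definition weight (j : placement * placement) : R :=
  (n ^_ #|assignments j|)%:R^-1.

Lemma weight_ge0 j : 0 <= weight j.
Proof. by rewrite invr_ge0 ler0n. Qed.

Lemma assignments_swap h1 h2 : assignments (h1, h2) = assignments (h2, h1).
Proof. by apply/setP=> y; rewrite !inE /= -!orbA; do 4!case: eqP => _. Qed.

Lemma collisions_swap h1 h2 : ((h1, h2) \in collisions) = ((h2, h1) \in collisions).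
Proof.
rewrite !inE /= assignments_swap andbCA (eq_sym (placed_edge h1)).
by rewrite (eq_sym (col (placed_edge h1))).
Qed.

Lemma collision_eq j y y' : j \in collisions ->
  y \in assignments j -> y' \in assignments j -> y.2 = y'.2 -> y = y'.
Proof.
rewrite inE => /and5P[_ _ _ _ /set0Pn[f /extendingP[/embeddingsP[fi _] fj]]].
move=> yj y'j e; rewrite (surjective_pairing y) (surjective_pairing y') e.
by congr pair; apply: fi; rewrite !fj.
Qed.

Lemma edge_placement_neq h : edge_placement h -> h.1 != h.2.
Proof.
by case/and4P=> _ lt _ _; apply: contraTneq lt => ->; rewrite ltnn.
Qed.

Definition meets (h : placement) (F : V * V) : bool :=
  [|| F.1 == h.1.2, F.1 == h.2.2, F.2 == h.1.2 | F.2 == h.2.2].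

(** Two distinct placed edges share at most one vertex, and in a collision a common image forces a
    common assignment; so one assignment is lost exactly when the images meet. *)
Lemma card_assignments h1 h2 : (h1, h2) \in collisions ->
  #|assignments (h1, h2)| = (if meets h1 (placed_edge h2) then 3 else 4)%N.
Proof.
move=> hbad; have := hbad; rewrite inE => /and5P[/= e1 e2 ne _ _].
have n1 := edge_placement_neq e1; have n2 := edge_placement_neq e2.
have inj y y' := @collision_eq _ y y' hbad.
case/and4P: e1 => _ lt1 _ _; case/and4P: e2 => _ lt2 _ _.
case: h1 h2 => [y1 y2] [y3 y4] /= in hbad ne n1 n2 lt1 lt2 inj *.
have in1 : y1 \in assignments ((y1, y2), (y3, y4)) by rewrite !inE eqxx.
have in2 : y2 \in assignments ((y1, y2), (y3, y4)) by rewrite !inE eqxx ?orbT.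
have in3 : y3 \in assignments ((y1, y2), (y3, y4)) by rewrite !inE eqxx ?orbT.
have in4 : y4 \in assignments ((y1, y2), (y3, y4)) by rewrite !inE eqxx ?orbT.
have eq2 y y' (yj : y \in assignments ((y1, y2), (y3, y4)))
    (y'j : y' \in assignments ((y1, y2), (y3, y4))) : (y.2 == y'.2) = (y == y').
  by apply/eqP/eqP=> [|-> //]; exact: inj.
move: ne; rewrite /meets /placed_edge xpair_eqE /= !eq2 // => ne.
(* Both edges point to the larger class index, so they cannot share both ends in reversed order. *)
have cross : ~~ ((y1 == y4) && (y2 == y3)).
  apply/negP=> /andP[/eqP e /eqP e']; subst y4 y3.
  by have := ltn_trans lt1 lt2; rewrite ltnn.
have [e31|n31] := eqVneq y3 y1.
  rewrite /= (@card_set_uniq _ _ [:: y1; y2; y4]) //.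
    subst y3; rewrite /= !inE !negb_or n1 n2 /= andbT.
    by move: ne; rewrite eqxx.
  by subst y3; move=> y; rewrite !inE /= -!orbA; case: (y == y1); case: (y == y2).
have [e32|n32] := eqVneq y3 y2.
  rewrite /= (@card_set_uniq _ _ [:: y1; y2; y4]) //.
    subst y3; rewrite /= !inE !negb_or n1 n2 /= andbT.
    by move: cross; rewrite eqxx andbT.
  by subst y3; move=> y; rewrite !inE /= -!orbA; case: (y == y1); case: (y == y2).
have [e41|n41] := eqVneq y4 y1.
  rewrite /= (@card_set_uniq _ _ [:: y1; y2; y3]) //.
    by rewrite /= !inE !negb_or n1 (eq_sym y1) n31 (eq_sym y2) n32.
  subst y4; move=> y; rewrite !inE /= -!orbA.
  by case: (y == y1); case: (y == y2); case: (y == y3).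
have [e42|n42] := eqVneq y4 y2.
  rewrite /= (@card_set_uniq _ _ [:: y1; y2; y3]) //.
    by rewrite /= !inE !negb_or n1 (eq_sym y1) n31 (eq_sym y2) n32.
  subst y4; move=> y; rewrite !inE /= -!orbA.
  by case: (y == y1); case: (y == y2); case: (y == y3).
rewrite /= (@card_set_uniq _ _ [:: y1; y2; y3; y4]) //.
  rewrite /= !inE !negb_or n1 n2 (eq_sym y1 y3) n31 (eq_sym y1) n41.
  by rewrite (eq_sym y2 y3) n32 (eq_sym y2) n42.
by move=> y; rewrite !inE -!orbA.
Qed.

Lemma card_placements (F : V * V) :
  (#|[set h | edge_placement h && (placed_edge h == F)]| <= n * Delta)%N.
Proof.
pose e (h : placement) := (h.1.1, h.2.1).
rewrite -(@card_in_imset _ _ e); last first.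
  move=> [[a p] [b q]] [[a' p'] [b' q']]; rewrite !inE /= /e.
  by move=> /andP[_ /eqP <-] /andP[_ /eqP[-> ->]] [-> ->].
apply: leq_trans (_ : #|[set u | cl u == F.1.1]| * Delta <= _)%N; last first.
  by rewrite leq_mul2r cl_fiber orbT.
apply: leq_trans (card_dep_pairs (fun x _ => degG x)).
apply: subset_leq_card; apply/subsetP=> _ /imsetP[h + ->].
by rewrite !inE => /andP[/and4P[? _ /eqP<- _] /eqP<-]; rewrite eqxx.
Qed.

Lemma card_placements_fst (F : V * V) (y : G * V) :
  (#|[set h | [&& edge_placement h, placed_edge h == F & h.1 == y]]| <= Delta)%N.
Proof.
pose e (h : placement) := h.2.1.
rewrite -(@card_in_imset _ _ e); last first.
  move=> [[a p] [b q]] [[a' p'] [b' q']]; rewrite !inE /= /e.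
  by move=> /and3P[_ /eqP <- /eqP<-] /and3P[_ /eqP[-> ->] /eqP[->]] /= ->.
apply: leq_trans (degG y.1); apply: subset_leq_card.
apply/subsetP=> _ /imsetP[h + ->].
by rewrite !inE => /and3P[/and4P[? _ _ _] _ /eqP<-].
Qed.

Lemma card_placements_snd (F : V * V) (y : G * V) :
  (#|[set h | [&& edge_placement h, placed_edge h == F & h.2 == y]]| <= Delta)%N.
Proof.
pose e (h : placement) := h.1.1.
rewrite -(@card_in_imset _ _ e); last first.
  move=> [[a p] [b q]] [[a' p'] [b' q']]; rewrite !inE /= /e.
  by move=> /and3P[_ /eqP <- /eqP<-] /and3P[_ /eqP[-> ->] /eqP[->]] /= ->.
apply: leq_trans (degG y.1); apply: subset_leq_card.
apply/subsetP=> _ /imsetP[h + ->].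
by rewrite !inE adj_sym => /and3P[/and4P[? _ _ _] _ /eqP<-].
Qed.

(** If [F] misses the image of [h1], at most [n * Delta] placements have weight [1 / n ^_ 4].
    Otherwise the common end is already assigned, leaving at most [Delta] placements of weight
    [1 / n ^_ 3], and [n ^_ 4 <= n * n ^_ 3]. *)
Lemma sum_weight_image (h1 : placement) (F : V * V) :
  \sum_(h2 | ((h1, h2) \in collisions) && (placed_edge h2 == F))
     weight (h1, h2) <= (n * Delta)%:R / (n ^_ 4)%:R.
Proof.
set X := [set h2 | ((h1, h2) \in collisions) && (placed_edge h2 == F)].
set w := ((n ^_ (if meets h1 F then 3 else 4))%:R^-1 : R).
have -> : \sum_(h2 | ((h1, h2) \in collisions) && (placed_edge h2 == F))
    weight (h1, h2) = #|X|%:R * w.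
  rewrite mulr_natl -sumr_const; apply: eq_big => h2; first by rewrite [RHS]inE.
  by case/andP=> hb /eqP eF; rewrite /weight card_assignments // eF.
have XF : X \subset [set h | edge_placement h && (placed_edge h == F)].
  apply/subsetP=> h2; rewrite [h2 \in X]inE => /andP[hb eF].
  by move: hb; rewrite !inE eF andbT => /and5P[].
rewrite {}/w; have [hm|_] := boolP (meets h1 F); last first.
  apply: ler_wpM2r; first by rewrite invr_ge0 ler0n.
  by rewrite ler_nat (leq_trans (subset_leq_card XF)) ?card_placements.
suff XD : (#|X| <= Delta)%N.
  have f3 : (0 < n ^_ 3)%N by rewrite ffact_gt0; lia.
  have f4 : (0 < n ^_ 4)%N by rewrite ffact_gt0; lia.
  rewrite ler_pdivrMr ?ltr0n // mulrAC ler_pdivlMr ?ltr0n // -!natrM ler_nat.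
  rewrite [(n ^_ 4)%N]ffactnSr mulnCA mulnC leq_mul2r; apply/orP; right.
  by rewrite mulnC; apply: leq_mul => //; exact: leq_subr.
have XE h2 : h2 \in X -> [/\ edge_placement h2, placed_edge h2 = F &
    forall y, y \in assignments (h1, h2) -> forall y', y' \in assignments (h1, h2) ->
      y.2 = y'.2 -> y = y'].
  move=> hX; have := subsetP XF _ hX; rewrite inE => /andP[-> /eqP ->]; split=> //.
  move: hX; rewrite inE => /andP[hb _] y yj y' y'j.
  exact: collision_eq hb yj y'j.
case/or4P: hm => /eqP eF.
- apply: leq_trans (card_placements_fst F h1.1); apply: subset_leq_card.
  apply/subsetP=> h2 /XE[e2 eF2 inj]; rewrite inE e2 eF2 eqxx /=; apply/eqP.
  by apply: inj; rewrite ?inE ?eqxx ?orbT // -eF -eF2.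
- apply: leq_trans (card_placements_fst F h1.2); apply: subset_leq_card.
  apply/subsetP=> h2 /XE[e2 eF2 inj]; rewrite inE e2 eF2 eqxx /=; apply/eqP.
  by apply: inj; rewrite ?inE ?eqxx ?orbT // -eF -eF2.
- apply: leq_trans (card_placements_snd F h1.1); apply: subset_leq_card.
  apply/subsetP=> h2 /XE[e2 eF2 inj]; rewrite inE e2 eF2 eqxx /=; apply/eqP.
  by apply: inj; rewrite ?inE ?eqxx ?orbT // -eF -eF2.
- apply: leq_trans (card_placements_snd F h1.2); apply: subset_leq_card.
  apply/subsetP=> h2 /XE[e2 eF2 inj]; rewrite inE e2 eF2 eqxx /=; apply/eqP.
  by apply: inj; rewrite ?inE ?eqxx ?orbT // -eF -eF2.
Qed.

(** The second edge lands on one of the at most [K] edges that have the color of the first. *)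
Lemma sum_weight_fst (h1 : placement) :
  \sum_(h2 | (h1, h2) \in collisions) weight (h1, h2)
    <= (K * (n * Delta))%:R / (n ^_ 4)%:R.
Proof.
pose Q := [set F : V * V | (F.1.1 < F.2.1)%N && (col F == col (placed_edge h1))].
rewrite (partition_big placed_edge (mem Q)) /=; last first.
  move=> h2; rewrite inE => /and5P[_ /and4P[_ lt /eqP e1 /eqP e2] _ c _].
  by rewrite inE /= e1 e2 lt eq_sym.
apply: le_trans (ler_sum _ _) _ => [F _|]; first exact: sum_weight_image.
rewrite sumr_const -[leLHS]mulr_natl (natrM _ K) -[leRHS]mulrA.
apply: ler_wpM2r; first by rewrite mulr_ge0 ?invr_ge0 ?ler0n.
by rewrite ler_nat col_bound.
Qed.

(** Once an end in [Z] is listed first, the other end is one of at most [Delta] neighbours, at one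
    of the [n] positions of its class. *)
Lemma card_touching (Z : {set G * V}) :
  (#|[set h | edge_placement h && ((h.1 \in Z) || (h.2 \in Z))]|
    <= #|Z| * (Delta * n))%N.
Proof.
pose r (y y' : G * V) := adj y.1 y'.1 && (y'.2.1 == cl y'.1).
have rD y : (#|[set y' | r y y']| <= Delta * n)%N.
  pose e (y' : G * V) := (y'.1, y'.2.2).
  rewrite -(@card_in_imset _ _ e); last first.
    move=> [a [i s]] [a' [i' s']]; rewrite !inE /= /e /=.
    by move=> /andP[_ /eqP /= ->] /andP[_ /eqP /= ->] [-> ->].
  apply: leq_trans (_ : #|setX [set b | adj y.1 b] [set: 'I_n]| <= _)%N.
    apply: subset_leq_card; apply/subsetP=> _ /imsetP[y' + ->].
    by rewrite !inE => /andP[->].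
  by rewrite cardsX cardsT card_ord leq_mul2r degG orbT.
apply: leq_trans (card_dep_pairs (fun y _ => rD y)).
(* Flipping loses nothing: the orientation by class index recovers the order of the ends. *)
pose flip (h : placement) := if h.1 \in Z then h else (h.2, h.1).
rewrite -(@card_in_imset _ _ flip); last first.
  move=> [y1 y2] [y3 y4]; rewrite !inE /flip /=.
  move=> /andP[/and4P[_ /= lt1 _ _] _] /andP[/and4P[_ /= lt2 _ _] _].
  case: ifP => _; case: ifP => _ [e1 e2]; rewrite ?e1 ?e2 //.
    by move: lt2; rewrite -e1 -e2 ltnNge ltnW.
  by move: lt2; rewrite -e1 -e2 ltnNge ltnW.
apply: subset_leq_card; apply/subsetP=> _ /imsetP[[y1 y2] + ->].
rewrite !inE /flip /r /= => /andP[/and4P[/= a _ c1 c2]].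
by case: ifP => /= [-> _|_ ->]; rewrite ?a ?c2 // adj_sym a c1.
Qed.

(** A common vertex leaves [n] images in its class; a common image leaves at most [n] vertices of
    that class. *)
Lemma card_clash (y : G * V) :
  (#|[set y' : G * V | (y'.2.1 == cl y'.1) && clash y y']| <= n + n)%N.
Proof.
apply: leq_trans (_ : #|[set y' : G * V | (y'.2.1 == cl y'.1) && (y.1 == y'.1)] :|:
  [set y' : G * V | (y'.2.1 == cl y'.1) && (y.2 == y'.2)]| <= _)%N.
  apply: subset_leq_card; apply/subsetP=> y'.
  by rewrite !inE -andb_orr.
apply: leq_trans (leq_card_setU _ _) _; apply: leq_add.
  rewrite -(@card_in_imset _ _ (fun y' : G * V => y'.2.2)); last first.
    move=> [a [i s]] [a' [i' s']]; rewrite !inE /=.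
    by move=> /andP[/eqP -> /eqP <-] /andP[/eqP -> /eqP <-] ->.
  by apply: leq_trans (max_card _) _; rewrite card_ord.
rewrite -(@card_in_imset _ _ fst); last first.
  move=> [a p] [a' p']; rewrite !inE /=.
  by move=> /andP[_ /eqP <-] /andP[_ /eqP <-] ->.
apply: leq_trans (cl_fiber y.2.1); apply: subset_leq_card.
apply/subsetP=> _ /imsetP[y' + ->].
by rewrite !inE => /andP[/eqP <- /eqP ->].
Qed.

Definition clashing (j j' : placement * placement) : bool :=
  [exists y in assignments j, exists y' in assignments j', clash y y'].

(** The factors are: 4 assignments of [j], 2 edges of [j'] that may be hit, [2n] clashing
    assignments, [Delta * n] placements through each, and [K * n * Delta / n ^_ 4] for the other
    edge. *)
Lemma sum_weight_clashing j :
  \sum_(j' in collisions | clashing j j') weight j' <= 4%:R^-1.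
Proof.
pose Z (y : G * V) := [set y' : G * V | (y'.2.1 == cl y'.1) && clash y y'].
pose TZ y := [set h | edge_placement h && ((h.1 \in Z y) || (h.2 \in Z y))].
pose B : R := (n + n)%:R * (Delta * n)%:R * ((K * (n * Delta))%:R / (n ^_ 4)%:R).
have B0 : 0 <= B by rewrite !mulr_ge0 ?invr_ge0 ?ler0n.
have fstB y : \sum_(h1 in TZ y) \sum_(h2 | (h1, h2) \in collisions) weight (h1, h2) <= B.
  apply: le_trans (ler_sum _ (fun h1 _ => sum_weight_fst h1)) _.
  rewrite sumr_const -[leLHS]mulr_natl; apply: ler_wpM2r.
    by rewrite mulr_ge0 ?invr_ge0 ?ler0n.
  rewrite -natrM ler_nat; apply: leq_trans (card_touching _) _.
  by rewrite leq_mul2r card_clash orbT.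
pose E (y : G * V) (b : bool) j' := (j' \in collisions) && ((if b then j'.1 else j'.2) \in TZ y).
have EB y b : \sum_(j' | E y b j') weight j' <= B.
  case: b; apply: le_trans (fstB y).
    rewrite pair_big_dep /=; rewrite le_eqVlt; apply/orP; left; apply/eqP.
    by apply: eq_big => -[h1 h2] //=; rewrite /E andbC.
  rewrite pair_big_dep /=.
  rewrite (reindex (fun j : placement * placement => (j.2, j.1))) /=; last first.
    by exists (fun j => (j.2, j.1)) => [[]|[]].
  rewrite le_eqVlt; apply/orP; left; apply/eqP; apply: eq_big => -[h1 h2] /=.
    by rewrite /E /= collisions_swap andbC.
  by move=> _; rewrite /weight assignments_swap.
have cover : \sum_(j' in collisions | clashing j j') weight j' <=
    \sum_(yb : (G * V) * bool | yb.1 \in assignments j) \sum_(j' | E yb.1 yb.2 j') weight j'.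
  apply: ler_sum_cover => [j'|j' /andP[jb /exists_inP[y yj /exists_inP[y' y'j cy]]]].
    exact: weight_ge0.
  have := jb; rewrite inE => /and5P[e1 e2 _ _ _].
  have /and4P[_ _ a1 a2] := e1; have /and4P[_ _ a3 a4] := e2.
  move: y'j; rewrite !inE -!orbA => /or4P[] /eqP ey'.
  - by exists (y, true); rewrite // /E /= jb !inE e1 -ey' cy ey' a1.
  - by exists (y, true); rewrite // /E /= jb !inE e1 -ey' cy ey' a2 orbT.
  - by exists (y, false); rewrite // /E /= jb !inE e2 -ey' cy ey' a3.
  - by exists (y, false); rewrite // /E /= jb !inE e2 -ey' cy ey' a4 orbT.
apply: le_trans cover _.
apply: le_trans (ler_sum _ (fun yb _ => EB yb.1 yb.2)) _.
rewrite sumr_const -[leLHS]mulr_natl.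
have c8 : (#|[pred yb : (G * V) * bool | yb.1 \in assignments j]| <= 8)%N.
  have -> : #|[pred yb : (G * V) * bool | yb.1 \in assignments j]| =
      #|setX (assignments j) [set: bool]|.
    by apply: eq_card => yb; rewrite !inE andbT.
  rewrite cardsX cardsT card_bool (leq_mul2r 2 _ 4) /=.
  rewrite /assignments; do 3 (apply: leq_trans (leq_card_setU _ _) _; rewrite [X in (_ + X)%N]cards1 addn1 ltnS).
  by rewrite cards1.
apply: (@le_trans _ _ (8%:R * B)); first by rewrite ler_wpM2r ?ler_nat.
have f4 : (0 < n ^_ 4)%N by rewrite ffact_gt0; lia.
rewrite /B !mulrA ler_pdivrMr ?ltr0n // ler_pdivlMl ?ltr0n // -!natrM ler_nat.
(* With denominators cleared, [n_large] and [ffact4_bound] give [64 * 110 * Delta ^ 2 * K * n ^ 3 <=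
   64 * n ^ 4 <= 110 * n ^_ 4]. *)
have := ffact4_bound n110; move: (n ^_ 4)%N f4 => f f4 le1.
have le2 : (110 * Delta ^ 2 * K * n ^ 3 <= n * n ^ 3)%N by rewrite leq_mul2r n_large orbT.
rewrite -(leq_pmul2l (isT : (0 < 110)%N)).
have -> : (110 * (4 * (8 * (n + n) * (Delta * n) * (K * (n * Delta)))) =
  64 * (110 * Delta ^ 2 * K * n ^ 3))%N by ring.
apply: leq_trans le1; rewrite leq_mul2l /=.
by apply: leq_trans le2 _; rewrite -expnS.
Qed.

Lemma exists_collision_free_embedding :
  exists2 f : {ffun G -> V}, f \in embeddings n cl &
    forall j, j \in collisions -> f \notin extending cl (assignments j).
Proof.
apply: (@lopsided_local_lemma R _ _ (embeddings n cl)
  (extending cl \o assignments) collisions clashing weight).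
- exact: weight_ge0.
- move=> j; apply/exists_inP; exists j.1.1; first by rewrite !inE eqxx.
  by apply/exists_inP; exists j.1.1; [rewrite !inE eqxx | rewrite /clash eqxx].
- by move=> j _; exact: sum_weight_clashing.
- move=> j S jb Sb NS /=.
  have f0 : (0 < n ^_ #|assignments j|)%N.
    rewrite ffact_gt0; case: j jb {NS} => h1 h2 jb.
    by rewrite card_assignments //; case: ifP => _; lia.
  rewrite /weight mulrC ler_pdivlMr ?ltr0n // -natrM ler_nat.
  apply: extending_negative_correlation => j' /NS N0 y y' yj y'j.
  apply: contra N0 => cy; apply/exists_inP; exists y => //.
  by apply/exists_inP; exists y'.
- exact: embeddings_neq0.
Qed.

End CollisionCount.

(** * From a collision-free embedding to a rainbow copy *)

Lemma set2_eqP (T : finType) (a b c d : T) :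
  [set a; b] = [set c; d] -> (a = c /\ b = d) \/ (a = d /\ b = c).
Proof.
move=> e; have := set22 a b; have := set21 a b; rewrite {1 2}e.
have := set22 c d; have := set21 c d; rewrite -{1 2}e.
by do 4!case/set2P=> ?; subst; auto.
Qed.

(** Some edge exists, and its color is used at least once. For the bound [n / (110 * Delta ^ 2)]
    this forces [n] to be at least 110. *)
Lemma globally_bounded_ge1 (R : realType) (m n : nat) (k : R)
    (c : coloring (complete_multipartite m n)) :
  (2 <= m)%N -> (1 <= n)%N -> globally_bounded k c -> 1 <= k.
Proof.
case: m n c => [|[|m]] // [|n] // c _ _ kb.
pose x : complete_multipartite m.+2 n.+1 := (ord0, ord0).
pose y : complete_multipartite m.+2 n.+1 := (ord_max, ord0).
apply: le_trans (kb (c [set x; y])); rewrite ler1n; apply/card_gt0P.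
exists [set x; y]; rewrite inE eqxx andbT.
by apply/imsetP; exists (x, y); rewrite ?inE.
Qed.

Section RainbowCopy.
Variables (G : sgraph) (m n : nat) (cl : G -> 'I_m).
Variable c : coloring (complete_multipartite m n).
Hypothesis clG : forall x y : G, adj x y -> cl x != cl y.

(** Two distinct image edges of equal color, oriented by class index, would form a collision
    realized by [f] itself. *)
Lemma rainbow_copy_of_embedding (f : {ffun G -> 'I_m * 'I_n}) :
  f \in embeddings n cl ->
  (forall j, j \in collisions cl (fun F => c [set F.1; F.2]) ->
     f \notin extending cl (assignments j)) ->
  has_rainbow_copy G c.
Proof.
move=> fE free; have /embeddingsP[fi fc] := fE.
pose F : {set {set complete_multipartite m n}} :=
  [set [set (f p.1 : complete_multipartite m n); f p.2] | p : G * G & adj p.1 p.2].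
exists (f @: [set: G]), F; split; [split; [split|]|].
- apply/subsetP=> _ /imsetP[[x y] + ->]; rewrite inE /= => axy.
  by apply/imsetP; exists (f x, f y); rewrite // inE /= /multipartite_adj !fc clG.
- move=> _ /imsetP[[x y] + ->]; rewrite inE /= => axy.
  by apply/subsetP=> z; rewrite !inE => /orP[] /eqP->; apply: imset_f.
- exists f; split=> // x y; apply/idP/imsetP => [axy|].
    by exists (x, y); rewrite ?inE.
  case=> [[u v]]; rewrite inE /= => auv /set2_eqP[] [/fi -> /fi ->] //.
  by rewrite adj_sym.
have orient E : E \in F -> exists x y, [/\ adj x y, (cl x < cl y)%N & E = [set f x; f y]].
  move=> /imsetP[[x y] + ->]; rewrite inE /= => axy.
  have := clG axy; rewrite neq_lt => /orP[] lt; first by exists x, y.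
  by exists y, x; rewrite adj_sym setUC.
move=> E E' /orient[x [y [axy lxy ->]]] /orient[u [v [auv luv ->]]] ec.
pose j := (((x, f x), (y, f y)), ((u, f u), (v, f v))).
have fj : f \in extending cl (assignments j).
  apply/extendingP; split=> // z.
  by rewrite !inE => /orP[/orP[/orP[]|]|] /eqP->.
have [e|ne] := eqVneq (f x, f y) (f u, f v); first by case: e => -> ->.
have := free j; rewrite fj /=; case/(_ _)/idPn; last by [].
rewrite inE /edge_placement /placed_edge /= axy auv lxy luv ne !fc !eqxx ec eqxx /=.
by apply/set0Pn; exists f.
Qed.

End RainbowCopy.

Theorem theorem1p4 (R : realType) (m n : nat) (hm : (2 <= m)%N) (hn : (1 <= n)%N)
    (G : sgraph) (Delta : nat) (hDelta : max_degree G = Delta)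
    (hDelta1 : (1 <= Delta)%N)
    (U : 'I_m -> {set G}) (hU : vertex_partition U)
    (hindep : forall i : 'I_m, independent (U i))
    (hsize : forall i : 'I_m, (#|U i| <= n)%N)
    (c : coloring (complete_multipartite m n))
    (hc : globally_bounded (n%:R / (110%:R * Delta%:R ^+ 2) : R) c) :
  has_rainbow_copy G c.
Proof.
have cover (u : G) : exists i, u \in U i.
  by have := in_setT u; rewrite -(proj1 hU) => /bigcupP[i _ ui]; exists i.
have [cl clU] := fin_all_exists cover.
have fiber i : [set u | cl u == i] = U i.
  apply/setP=> u; rewrite inE; apply/eqP/idP => [<- //|ui].
  apply/eqP; apply: contraTT ui => ne.
  by have /disjointFr-> := proj2 hU _ _ ne.
have clG (x y : G) : adj x y -> cl x != cl y.
  move=> axy; apply/negP=> /eqP e.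
  by have := hindep (cl x) x y (clU x); rewrite e clU axy => /(_ isT).
have D0 : (0 < 110 * Delta ^ 2)%N by rewrite muln_gt0 expn_gt0 hDelta1.
have hcn (k : nat) : k%:R <= n%:R / (110%:R * Delta%:R ^+ 2) :> R ->
    (k * (110 * Delta ^ 2) <= n)%N.
  by rewrite -natrX -natrM ler_pdivlMr ?ltr0n // -natrM ler_nat.
have n110 : (110 <= n)%N.
  have := hcn 1%N (globally_bounded_ge1 hm hn hc); rewrite mul1n; apply: leq_trans.
  by rewrite leq_pmulr // expn_gt0 hDelta1.
(* Color multiplicities are integers, so the real bound may be rounded down. *)
pose K := (n %/ (110 * Delta ^ 2))%N.
have [||||f fE free] := @exists_collision_free_embedding R G m n Delta K cl
    (fun F => c [set F.1; F.2]) _ _ _ _ n110.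
- by move=> x; rewrite -hDelta; apply: (leq_bigmax (F := fun x : G => #|[set y | adj x y]|)).
- by move=> i; rewrite fiber.
- move=> j; rewrite leq_divRL //; apply: leq_trans (hcn _ (hc j)).
  rewrite leq_mul2r; apply/orP; right.
  (* On pairs ordered by class index, forgetting the order is injective, so the bound on edges of
     one color carries over to ordered pairs. *)
  pose e (F : ('I_m * 'I_n) * ('I_m * 'I_n)) : {set complete_multipartite m n} :=
    [set F.1; F.2].
  rewrite -(@card_in_imset _ _ e); last first.
    move=> [p q] [r s]; rewrite !inE /= => /andP[lt1 _] /andP[lt2 _].
    case/set2_eqP=> -[/= e1 e2]; first by rewrite e1 e2.
    by move: lt2; rewrite -e1 -e2 ltnNge ltnW.
  apply: subset_leq_card; apply/subsetP=> _ /imsetP[F + ->].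
  rewrite !inE => /andP[lt ->]; rewrite andbT; apply/imsetP; exists F => //.
  by rewrite inE /= /multipartite_adj neq_lt; apply/orP; left.
- by rewrite mulnC; exact: leq_divM.
exact: rainbow_copy_of_embedding clG _ fE free.
Qed.
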